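(* Let $D_1=D_2$ be an equation of diagrams in $\mathrm{RING}_{\mathbb C}$, $\mathrm{ZW}_{\mathbb C}$ or $\mathrm{ZH}_{\mathbb C}$ (without !-boxes) whose phases are polynomials in some phase variables $\alpha_1,\dots,\alpha_n$. Then there exists a single equation of diagrams without any phase variables that verifies $D_1=D_2$. If one can put an upper bound on the degrees of the minimal polynomials of the phase constants appearing in $D_1,D_2$, then one can construct such an equation.
   Context: Each calculus has a strict symmetric monoidal interpretation $\llbracket\cdot\rrbracket$ of diagrams $n\to m$ as complex matrices with $2^n$ columns and $2^m$ rows; wires, swaps, cups $(1\,0\,0\,1)^T$ and caps $(1\,0\,0\,1)$ are as usual. Further generators (labels are called phases): - $\mathrm{RING}_{\mathbb C}$: states $0\to1$ labelled $a\in\mathbb C$, $(1,a)^T$; multiplication $2\to1$, $\begin{pmatrix}1&0&0&0\\0&0&0&1\end{pmatrix}$; addition $2\to1$, $\begin{pmatrix}1&0&0&0\\0&1&1&0\end{pmatrix}$. - $\mathrm{ZW}_{\mathbb C}$: white spiders labelled $r\in\mathbb C$, $|0\cdots0\rangle\langle0\cdots0|+r|1\cdots1\rangle\langle1\cdots1|$; black spiders $0\to n$, $\sum_{k=1}^n|0^{k-1}1\,0^{n-k}\rangle$; crossing $2\to2$, $\begin{pmatrix}1&0&0&0\\0&0&1&0\\0&1&0&0\\0&0&0&-1\end{pmatrix}$. - $\mathrm{ZH}_{\mathbb C}$: unlabelled white spiders $|0\cdots0\rangle\langle0\cdots0|+|1\cdots1\rangle\langle1\cdots1|$; H-boxes labelled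 $r\in\mathbb C$, $\sum r^{i_1\cdots i_mj_1\cdots j_n}|j_1\cdots j_n\rangle\langle i_1\cdots i_m|$ (sum over bits). A phase variable is a formal variable in the phases; instantiating it means replacing all its occurrences, on both sides of the equation, by a given complex number. The phase constants are the complex numbers occurring (as coefficients) in the phases. An equation without phase variables is sound if both sides have equal interpretation; an equation with phase variables is sound if all its instantiations are. A set of equations verifies an equation $\mathbb E$ if soundness of all equations in the set implies soundness of $\mathbb E$. *)

(* Defs.v *)
From HB Require Import structures.
From mathcomp Require Import all_boot all_order all_algebra.
From mathcomp Require Import reals complex mxtens mpoly.

Set Implicit Arguments.
Unset Strict Implicit.
Unset Printing Implicit Defensive.

Import GRing.Theory Num.Theory.
Local Open Scope ring_scope.

(** * Diagrams *)

Inductive calculus := RING | ZW | ZH.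

(* [generator P k n m]: generators n -> m of the calculus k, phases in P. *)
Inductive generator (P : Type) : calculus -> nat -> nat -> Type :=
| RingState (a : P) : generator P RING 0 1
| RingMul : generator P RING 2 1
| RingAdd : generator P RING 2 1
| ZWWhite n m (r : P) : generator P ZW n m
| ZWBlack n : generator P ZW 0 n
| ZWCrossing : generator P ZW 2 2
| ZHWhite n m : generator P ZH n m
| ZHBox n m (r : P) : generator P ZH n m.

Arguments RingMul {P}.
Arguments RingAdd {P}.
Arguments ZWBlack {P} n.
Arguments ZWCrossing {P}.
Arguments ZHWhite {P} n m.

(* [Comp D2 D1] is D1 followed by D2. *)
Inductive diagram (P : Type) (k : calculus) : nat -> nat -> Type :=
| Empty : diagram P k 0 0
| Wire : diagram P k 1 1
| Swap : diagram P k 2 2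
| Cup : diagram P k 0 2
| Cap : diagram P k 2 0
| Gen n m (g : generator P k n m) : diagram P k n m
| Comp n m l (D2 : diagram P k m l) (D1 : diagram P k n m) : diagram P k n l
| Tens n1 m1 n2 m2 (D1 : diagram P k n1 m1) (D2 : diagram P k n2 m2) :
    diagram P k (n1 + n2) (m1 + m2).

Arguments Empty {P k}.
Arguments Wire {P k}.
Arguments Swap {P k}.
Arguments Cup {P k}.
Arguments Cap {P k}.

Record equation (P : Type) (k : calculus) := Equation {
  dom : nat;
  cod : nat;
  lhs : diagram P k dom cod;
  rhs : diagram P k dom cod
}.

Definition gmap P Q (f : P -> Q) k n m (g : generator P k n m) :
    generator Q k n m :=
  match g in generator _ k n m return generator Q k n m with
  | RingState a => RingState (f a)
  | RingMul => RingMul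
  | RingAdd => RingAdd
  | ZWWhite n m r => ZWWhite n m (f r)
  | ZWBlack n => ZWBlack n
  | ZWCrossing => ZWCrossing
  | ZHWhite n m => ZHWhite n m
  | ZHBox n m r => ZHBox n m (f r)
  end.

Fixpoint dmap P Q (f : P -> Q) k n m (D : diagram P k n m) : diagram Q k n m :=
  match D in diagram _ _ n m return diagram Q k n m with
  | Empty => Empty
  | Wire => Wire
  | Swap => Swap
  | Cup => Cup
  | Cap => Cap
  | Gen n m g => Gen (gmap f g)
  | Comp n m l D2 D1 => Comp (dmap f D2) (dmap f D1)
  | Tens n1 m1 n2 m2 D1 D2 => Tens (dmap f D1) (dmap f D2)
  end.

Definition emap P Q (f : P -> Q) k (E : equation P k) : equation Q k :=
  Equation (dmap f (lhs E)) (dmap f (rhs E)).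

Definition gphases P k n m (g : generator P k n m) : seq P :=
  match g with
  | RingState a => [:: a]
  | ZWWhite _ _ r => [:: r]
  | ZHBox _ _ r => [:: r]
  | _ => [::]
  end.

Fixpoint dphases P k n m (D : diagram P k n m) : seq P :=
  match D with
  | Gen _ _ g => gphases g
  | Comp _ _ _ D2 D1 => dphases D2 ++ dphases D1
  | Tens _ _ _ _ D1 D2 => dphases D1 ++ dphases D2
  | _ => [::]
  end.

Definition ephases P k (E : equation P k) : seq P :=
  dphases (lhs E) ++ dphases (rhs E).

(** * Interpretation *)

Section Interpretation.
Variable R : comNzRingType.

Definition mx_of_rows n m (rows : seq (seq R)) : 'M[R]_(n, m) :=
  \matrix_(i, j) nth 0 (nth [::] rows i) j.

(* The basis vector |b>; the leftmost bit is the most significant one, which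
   matches the Kronecker product [*t]. *)
Definition ket n (b : n.-tuple bool) : 'cV[R]_(2 ^ n) :=
  \col_i ((i : nat) == \sum_(k < n) tnth b k * 2 ^ (n - k.+1))%N%:R.

Definition white_mx n m (r : R) : 'M[R]_(2 ^ m, 2 ^ n) :=
  ket [tuple of nseq m false] *m (ket [tuple of nseq n false])^T
  + r *: (ket [tuple of nseq m true] *m (ket [tuple of nseq n true])^T).

Definition black_mx n : 'M[R]_(2 ^ n, 2 ^ 0) :=
  \sum_(k < n) ket [tuple i == k | i < n].

Definition hbox_mx n m (r : R) : 'M[R]_(2 ^ m, 2 ^ n) :=
  \sum_(i : n.-tuple bool) \sum_(j : m.-tuple bool)
    r ^+ (\prod_(k < n) tnth i k * \prod_(k < m) tnth j k)%N
      *: (ket j *m (ket i)^T).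

Definition ginterp k n m (g : generator R k n m) : 'M[R]_(2 ^ m, 2 ^ n) :=
  match g in generator _ _ n m return 'M[R]_(2 ^ m, 2 ^ n) with
  | RingState a => mx_of_rows _ _ [:: [:: 1]; [:: a]]
  | RingMul => mx_of_rows _ _ [:: [:: 1; 0; 0; 0]; [:: 0; 0; 0; 1]]
  | RingAdd => mx_of_rows _ _ [:: [:: 1; 0; 0; 0]; [:: 0; 1; 1; 0]]
  | ZWWhite n m r => white_mx n m r
  | ZWBlack n => black_mx n
  | ZWCrossing => mx_of_rows _ _ [:: [:: 1; 0; 0; 0]; [:: 0; 0; 1; 0];
                                     [:: 0; 1; 0; 0]; [:: 0; 0; 0; -1]]
  | ZHWhite n m => white_mx n m 1
  | ZHBox n m r => hbox_mx n m r
  end.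

Fixpoint interp k n m (D : diagram R k n m) : 'M[R]_(2 ^ m, 2 ^ n) :=
  match D in diagram _ _ n m return 'M[R]_(2 ^ m, 2 ^ n) with
  | Empty => 1%:M
  | Wire => 1%:M
  | Swap => mx_of_rows _ _ [:: [:: 1; 0; 0; 0]; [:: 0; 0; 1; 0];
                               [:: 0; 1; 0; 0]; [:: 0; 0; 0; 1]]
  | Cup => mx_of_rows _ _ [:: [:: 1]; [:: 0]; [:: 0]; [:: 1]]
  | Cap => mx_of_rows _ _ [:: [:: 1; 0; 0; 1]]
  | Gen n m g => ginterp g
  | Comp n m l D2 D1 => interp D2 *m interp D1
  | Tens n1 m1 n2 m2 D1 D2 =>
      castmx (esym (expnD 2 m1 m2), esym (expnD 2 n1 n2))
             (interp D1 *t interp D2)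
  end.

End Interpretation.

(** * Soundness and verification *)

Section Soundness.
Variables (C : comNzRingType) (k : calculus).

(* Equations without phase variables have phases in C, equations with the n
   phase variables 'X_0, ..., 'X_(n-1) have phases in {mpoly C[n]}. *)
Definition sound_closed (E : equation C k) : Prop :=
  interp (lhs E) = interp (rhs E).

Definition instantiate n (a : 'I_n -> C) (E : equation {mpoly C[n]} k) :
  equation C k := emap (meval a) E.

Definition sound n (E : equation {mpoly C[n]} k) : Prop :=
  forall a : 'I_n -> C, sound_closed (instantiate a E).

Definition verifies (S : equation C k -> Prop) n
    (E : equation {mpoly C[n]} k) : Prop :=
  (forall F, S F -> sound_closed F) -> sound E.

Definition single (F : equation C k) : equation C k -> Prop := eq F.

Definition instance_of n (F : equation C k) (E : equation {mpoly C[n]} k) :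
  Prop := exists a : 'I_n -> C, F = instantiate a E.

Definition phase_constants n (E : equation {mpoly C[n]} k) : seq C :=
  flatten [seq [seq p@_m | m <- msupp p] | p <- ephases E].

End Soundness.

Definition minimal_polynomial (C : numFieldType) (z : C) (p : {poly rat}) :
    Prop :=
  [/\ p \is monic, root (map_poly ratr p) z
    & forall q : {poly rat}, root (map_poly ratr q) z -> p %| q].

(** * Finite descriptions of phases *)

(* A construction cannot read arbitrary complex numbers, so the phase constants
   are given to it by names (j : nat), which an environment [rho : nat -> C]
   maps to complex numbers.  A polynomial is described by its list of terms
   (name of the coefficient, exponents); every polynomial arises so. *)
Definition named_poly n := seq (nat * 'X_{1..n}).

Definition npoly_val (C : comNzRingType) (rho : nat -> C) n
    (s : named_poly n) : {mpoly C[n]} :=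
  \sum_(t <- s) rho t.1 *: 'X_[t.2].

(* Explicit complex numbers, by radicals over the named constants. *)
Inductive radical :=
| NConst (j : nat)
| NNat (n : nat)
| NAdd (e1 e2 : radical)
| NMul (e1 e2 : radical)
| NOpp (e : radical)
| NInv (e : radical)
| NExp (e : radical) (n : nat)
| NRoot (n : nat) (e : radical).

Fixpoint radical_val (C : numClosedFieldType) (rho : nat -> C) (e : radical) :
    C :=
  match e with
  | NConst j => rho j
  | NNat n => n%:R
  | NAdd e1 e2 => radical_val rho e1 + radical_val rho e2
  | NMul e1 e2 => radical_val rho e1 * radical_val rho e2
  | NOpp e => - radical_val rho e
  | NInv e => (radical_val rho e)^-1
  | NExp e n => radical_val rho e ^+ n
  | NRoot n e => n.-root (radical_val rho e)
  end.

(** * Computable functions *)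

(* Total recursive functions over binary trees instead of natural numbers: the
   finite data above are then coded without any arithmetic. *)
Inductive tree := Leaf | Node (t u : tree).

Definition tfst t := if t is Node a _ then a else Leaf.
Definition tsnd t := if t is Node _ b then b else Leaf.

Fixpoint tnat (n : nat) : tree := if n is n'.+1 then Node Leaf (tnat n') else Leaf.

Fixpoint primrec (g h : tree -> tree) (x t : tree) : tree :=
  match t with
  | Leaf => g x
  | Node a b => h (Node x (Node t (Node (primrec g h x a) (primrec g h x b))))
  end.

(* The last constructor is minimisation, restricted as usual to the cases in
   which it yields a total function. *)
Inductive computable : (tree -> tree) -> Prop :=
| computable_id : computable (fun x => x)
| computable_leaf : computable (fun _ => Leaf)
| computable_fst : computable tfst
| computable_snd : computable tsnd
| computable_node f g : computable f -> computable g ->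
    computable (fun x => Node (f x) (g x))
| computable_comp f g : computable f -> computable g ->
    computable (fun x => f (g x))
| computable_primrec g h : computable g -> computable h ->
    computable (fun z => primrec g h (tfst z) (tsnd z))
| computable_mu g h : computable g ->
    (forall x, exists n, [/\ h x = tnat n, g (Node x (tnat n)) = Leaf
       & forall m, (m < n)%N -> g (Node x (tnat m)) <> Leaf]) ->
    computable h.

Fixpoint tlist (s : seq tree) : tree :=
  if s is t :: s' then Node t (tlist s') else Leaf.

Definition code (tag : nat) (s : seq tree) : tree := Node (tnat tag) (tlist s).

Definition code_npoly n (s : named_poly n) : tree :=
  tlist [seq Node (tnat t.1) (tlist [seq tnat i | i <- (t.2 : 'X_{1..n})])
        | t <- s].

Fixpoint code_radical (e : radical) : tree :=
  match e with
  | NConst j => code 0 [:: tnat j]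
  | NNat n => code 1 [:: tnat n]
  | NAdd e1 e2 => code 2 [:: code_radical e1; code_radical e2]
  | NMul e1 e2 => code 3 [:: code_radical e1; code_radical e2]
  | NOpp e => code 4 [:: code_radical e]
  | NInv e => code 5 [:: code_radical e]
  | NExp e n => code 6 [:: code_radical e; tnat n]
  | NRoot n e => code 7 [:: tnat n; code_radical e]
  end.

Section CodeDiagram.
Variables (P : Type) (cP : P -> tree).

Definition code_generator k n m (g : generator P k n m) : tree :=
  match g with
  | RingState a => code 0 [:: cP a]
  | RingMul => code 1 [::]
  | RingAdd => code 2 [::]
  | ZWWhite n m r => code 3 [:: tnat n; tnat m; cP r]
  | ZWBlack n => code 4 [:: tnat n]
  | ZWCrossing => code 5 [::]
  | ZHWhite n m => code 6 [:: tnat n; tnat m]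
  | ZHBox n m r => code 7 [:: tnat n; tnat m; cP r]
  end.

Fixpoint code_diagram k n m (D : diagram P k n m) : tree :=
  match D with
  | Empty => code 0 [::]
  | Wire => code 1 [::]
  | Swap => code 2 [::]
  | Cup => code 3 [::]
  | Cap => code 4 [::]
  | Gen _ _ g => code 5 [:: code_generator g]
  | Comp _ _ _ D2 D1 => code 6 [:: code_diagram D2; code_diagram D1]
  | Tens _ _ _ _ D1 D2 => code 7 [:: code_diagram D1; code_diagram D2]
  end.

Definition code_equation k (E : equation P k) : tree :=
  Node (code_diagram (lhs E)) (code_diagram (rhs E)).

End CodeDiagram.

(* Main.v *)
Require Import Defs.
From mathcomp Require Import all_boot all_order all_algebra all_field.
From mathcomp Require Import zify.
From mathcomp Require Import reals complex mxtens mpoly.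
From mathcomp Require boolp.

Set Implicit Arguments.
Unset Strict Implicit.
Unset Printing Implicit Defensive.

Import GRing.Theory Num.Theory.
Local Open Scope ring_scope.

(* For the existence part, an unsound equation has an unsound instance, and any
   instance of a sound one will do.

   For the construction, let z be the N-th root of 2 and substitute z^(B^i) for
   the i-th phase variable.  The matrix entries of both sides are polynomials of
   total degree < B over the number field K generated by the c phase constants,
   and [K : Q] <= d^c.  Kronecker's substitution turns a nonzero difference of
   entries into a nonzero polynomial over K of degree < B^n; if z were one of its
   roots, z would have degree at most d^c (B^n - 1) over Q.  Since X^N - 2 is
   irreducible by Eisenstein's criterion, this is impossible for large N.  As
   n, d, c and the degrees are bounded by the size B of the input tree, N = B^B
   suffices, and this substitution is primitive recursive. *)

(** * Number fields *)

(** Among the nonzero polynomials vanishing at [z], one of least size is irreducible; hence the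
    descent on the size. *)
Lemma exists_irreducible_root (F L : fieldType) (iota : {rmorphism F -> L})
    (z : L) (q : {poly F}) :
  q != 0 -> root (map_poly iota q) z ->
  exists p : {poly F}, [/\ irreducible_poly p, root (map_poly iota p) z
    & (size p <= size q)%N].
Proof.
elim: {q}_.+1 {-2}q (ltnSn (size q)) => // s IHs q leq_q nz_q qz0.
have [irr_q | nirr_q] := boolp.EM (irreducible_poly q); first by exists q.
have [r [nz_r rz0 lt_rq]] : exists r : {poly F},
    [/\ r != 0, root (map_poly iota r) z & (size r < size q)%N].
  apply: boolp.contrapT => no_r; apply: nirr_q.
  apply/(subfx_irreducibleP qz0 nz_q) => r rz0 nz_r.
  by rewrite leqNgt; apply/negP => lt_rq; apply: no_r; exists r.
have [p [irr_p pz0 le_pr]] := IHs r (leq_trans lt_rq leq_q) nz_r rz0.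
by exists p; split=> //; apply: leq_trans le_pr (ltnW lt_rq).
Qed.

(** [F'] is the quotient of the polynomials over [F] by an irreducible one vanishing at [z],
    regarded as an extension of [F0]; [iota'] sends the class of the indeterminate to [z]. As [q]
    itself may be reducible, the dimension is only bounded. *)
Lemma adjoin_root (F0 L : fieldType) (F : fieldExtType F0)
    (iota : {rmorphism F -> L}) (z : L) (q : {poly F}) :
  q != 0 -> root (map_poly iota q) z ->
  exists (F' : fieldExtType F0) (iota' : {rmorphism F' -> L}),
    [/\ (\dim {:F'} <= \dim {:F} * (size q).-1)%N,
        forall x, exists y, iota' y = iota x & exists y, iota' y = z].
Proof.
move=> nz_q qz0.
have [p [irr_p pz0 le_pq]] := exists_irreducible_root nz_q qz0.
pose F1 := SubFieldExtType pz0 irr_p.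
pose iota1 : {rmorphism baseFieldType F1 -> L} := @subfx_inj F L iota z p.
exists (baseFieldType F1), iota1; split.
(* Dimensions multiply in the tower from [F0] through [F] to [F1]. *)
- have -> : \dim {:baseFieldType F1} = (\dim {:F1} * \dim {:F})%N.
    rewrite -dim_baseVspace; congr (\dim _); apply/vspaceP=> x.
    by rewrite mem_baseVspace [LHS]memvf [RHS]memvf.
  rewrite mulnC leq_mul2l; apply/orP; right.
  have -> : \dim {:F1} = (size p).-1 by exact: (dimvf (F1 : vectType _)).
  by rewrite -!subn1 leq_sub2r.
- by move=> x; exists ((x%:A : F1) : baseFieldType F1); exact: (subfx_inj_base pz0 (irredp_neq0 irr_p)).
- exists (subfx_root iota z p); exact: (subfx_inj_root pz0 (irredp_neq0 irr_p)).
Qed.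

Definition in_image (F L : fieldType) (iota : {rmorphism F -> L}) (c : L) :=
  exists x, iota x = c.

(** Being irreducible, [p] has least size among the nonzero polynomials vanishing at [x]. Its degree
    is thus at most that of the minimal polynomial of [x], which is the dimension of the subfield
    generated by [x]. *)
Lemma irreducible_size_root (F : fieldExtType rat) (x : F) (p : {poly rat}) :
  irreducible_poly p -> root (map_poly (in_alg F) p) x ->
  ((size p).-1 <= \dim {:F})%N.
Proof.
move=> irr_p px0; have [g Dg] := polyOver1P (minPolyOver 1%AS x).
have g_x0 : root (map_poly (in_alg F) g) x by rewrite -Dg root_minPoly.
have nz_p := irredp_neq0 irr_p.
have /(subfx_irreducibleP px0 nz_p)/(_ _ g_x0) le_pg := irr_p.
have nz_g : g != 0.
  by rewrite -(map_poly_eq0 (in_alg F)) -Dg monic_neq0 ?monic_minPoly.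
apply: leq_trans (dimvS (subvf <<1; x>>)).
rewrite dim_Fadjoin dimv1 muln1 -ltnS -size_minPoly Dg size_map_poly.
by rewrite -polySpred // le_pg.
Qed.

(** There is only one ring morphism from the rationals to [L]. *)
Lemma map_poly_rat (F : fieldExtType rat) (L : numFieldType)
    (iota : {rmorphism F -> L}) (p : {poly rat}) :
  map_poly iota (map_poly (in_alg F) p) = map_poly ratr p.
Proof.
rewrite -map_poly_comp; apply: eq_map_poly => a.
exact: (fmorph_eq_rat (GRing.RMorphism.clone _ _ (iota \o in_alg F) _)).
Qed.

(** The elements of [s] are adjoined one at a time. Their rational polynomials remain available over
    each intermediate field, so every step multiplies the dimension by at most [d]. *)
Lemma number_field (L : numFieldType) (d : nat) (s : seq L) :
  (forall c, c \in s -> exists p : {poly rat},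
     [/\ p != 0, root (map_poly ratr p) c & ((size p).-1 <= d)%N]) ->
  exists (F : fieldExtType rat) (iota : {rmorphism F -> L}),
    (\dim {:F} <= d ^ size s)%N /\ forall c, c \in s -> in_image iota c.
Proof.
elim: s => [_|c s IHs alg_s].
  exists rat^o, (ratr : {rmorphism rat -> L}); split=> //.
  by rewrite dimvf.
have [F [iota [dimF sF]]] := IHs (fun b sb => alg_s b (mem_behead (s := c :: s) sb)).
have [p [nz_p pc0 le_pd]] := alg_s c (mem_head c s).
have [||F' [iota' [dimF' sFF' cF']]] :=
    @adjoin_root _ _ F iota c (map_poly (in_alg F) p).
- by rewrite map_poly_eq0.
- by rewrite map_poly_rat.
exists F', iota'; split.
  apply: leq_trans dimF' _; rewrite size_map_poly mulnC expnS.
  exact: leq_mul.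
move=> b; rewrite inE => /predU1P[-> // | /sF[x <-]].
exact: sFF'.
Qed.

(** Eisenstein's criterion at the prime 2, applied to the integer polynomial. *)
Lemma irreducible_Xn_sub2 (N : nat) :
  (0 < N)%N -> irreducible_poly ('X^N - 2%:P : {poly rat}).
Proof.
move=> N_gt0.
have Xn_sub2 : map_poly intr ('X^N - 2%:P) = 'X^N - 2%:P :> {poly rat}.
  by rewrite rmorphB /= map_polyXn map_polyC.
have sz2 : size ('X^N - 2%:P : {poly int}) = N.+1 by rewrite size_XnsubC.
rewrite -Xn_sub2; apply/irreducible_rat_int.
apply: (@eisenstein_crit 2) => //.
- by rewrite sz2 eqSS -lt0n.
- by rewrite lead_coefDl ?lead_coefXn // size_polyN size_polyXn size_polyC.
- by rewrite coefB coefXn coefC eq_sym (gtn_eqF N_gt0).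
- move=> i; rewrite sz2 /= => lt_iN.
  by rewrite coefB coefXn coefC (ltn_eqF lt_iN); case: i {lt_iN}.
Qed.

(** If [q] vanished at [z], adjoining [z] to [F] would give a field of dimension below [N] over the
    rationals that contains a root of an irreducible polynomial of degree [N]. *)
Lemma root_two_not_root (F : fieldExtType rat) (L : numFieldType)
    (iota : {rmorphism F -> L}) (N : nat) (z : L) (q : {poly F}) :
  (0 < N)%N -> z ^+ N = 2 -> q != 0 -> (\dim {:F} * (size q).-1 < N)%N ->
  ~~ root (map_poly iota q) z.
Proof.
move=> N_gt0 zN2 nz_q lt_qN; apply/negP => qz0.
have [F' [iota' [dimF' _ [x xz]]]] := adjoin_root nz_q qz0.
have szX : size ('X^N - 2%:P : {poly rat}) = N.+1 by rewrite size_XnsubC.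
suffices /(irreducible_size_root (irreducible_Xn_sub2 N_gt0)) :
    root (map_poly (in_alg F') ('X^N - 2%:P)) x.
  by rewrite szX => /leq_trans/(_ dimF'); rewrite leqNgt lt_qN.
rewrite -(fmorph_root iota') map_poly_rat xz rmorphB /= map_polyXn map_polyC /=.
by rewrite rootE !hornerE zN2 rmorph_nat subrr.
Qed.


(** * Interpretation under ring morphisms and degree bounds *)

Section MapDiagram.
Variable k : calculus.

Lemma dmap_comp P Q S (f : Q -> S) (g : P -> Q) n m (D : diagram P k n m) :
  dmap f (dmap g D) = dmap (f \o g) D.
Proof.
elim: D => //= [n' m' []|n' m' l D2 -> D1 ->|n1 m1 n2 m2 D1 -> D2 ->] //.
Qed.

Lemma dmap_id P n m (D : diagram P k n m) : dmap id D = D.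
Proof. by elim: D => //= [n' m' []|n' m' l D2 -> D1 ->|n1 m1 n2 m2 D1 -> D2 ->]. Qed.

Lemma dphases_dmap P Q (f : P -> Q) n m (D : diagram P k n m) :
  dphases (dmap f D) = map f (dphases D).
Proof.
by elim: D => //= [n' m' []|n' m' l D2 -> D1 ->|n1 m1 n2 m2 D1 -> D2 ->] //;
  rewrite map_cat.
Qed.

Lemma eq_in_dmap (P : eqType) Q (f g : P -> Q) n m (D : diagram P k n m) :
  {in dphases D, f =1 g} -> dmap f D = dmap g D.
Proof.
elim: D => //= [n' m' [] //= >|n' m' l D2 IH2 D1 IH1|n1 m1 n2 m2 D1 IH1 D2 IH2] fg.
1-3: by rewrite fg ?mem_head.
all: by rewrite IH1 ?IH2 // => x xD; apply: fg; rewrite mem_cat xD ?orbT.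
Qed.

Variables (R S : comNzRingType) (f : {rmorphism R -> S}).

Lemma map_mx_of_rows n m rows :
  map_mx f (mx_of_rows (R := R) n m rows) = mx_of_rows (R := S) n m (map (map f) rows).
Proof.
apply/matrixP=> i j; rewrite !mxE.
(* Entries outside the given lists default to 0, which [f] preserves. *)
have [lt_i|le_i] := ltnP i (size rows); last first.
  by rewrite !(nth_default [::]) ?size_map // !nth_nil rmorph0.
rewrite (nth_map [::]) //.
have [lt_j|le_j] := ltnP j (size (nth [::] rows i)).
  by rewrite (nth_map 0).
by rewrite !(nth_default 0) ?size_map // rmorph0.
Qed.

Lemma map_ket n b : map_mx f (ket R b) = ket S (b : n.-tuple bool).
Proof. by apply/matrixP=> i j; rewrite !mxE rmorph_nat. Qed.

Lemma map_white_mx n m r : map_mx f (white_mx n m r) = white_mx n m (f r).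
Proof. by rewrite /white_mx map_mxD map_mxZ !map_mxM -!map_trmx !map_ket. Qed.

Lemma map_black_mx n : map_mx f (black_mx R n) = black_mx S n.
Proof. by rewrite /black_mx map_mx_sum; apply: eq_bigr => i _; rewrite map_ket. Qed.

Lemma map_hbox_mx n m r : map_mx f (hbox_mx n m r) = hbox_mx n m (f r).
Proof.
rewrite /hbox_mx map_mx_sum; apply: eq_bigr => i _.
rewrite map_mx_sum; apply: eq_bigr => j _.
by rewrite map_mxZ rmorphXn map_mxM -map_trmx !map_ket.
Qed.

(** The entries of a generator are integer polynomials in its phase. This gives both the descent to
    a subfield and the passage to an instance. *)
Lemma map_interp n m (D : diagram R k n m) :
  map_mx f (interp D) = interp (dmap f D).
Proof.
elim: D => [|||||n' m' g|n' m' l D2 IH2 D1 IH1|n1 m1 n2 m2 D1 IH1 D2 IH2] /=.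
- exact: map_mx1.
- exact: map_mx1.
- by rewrite map_mx_of_rows /= rmorph0 rmorph1.
- by rewrite map_mx_of_rows /= rmorph0 rmorph1.
- by rewrite map_mx_of_rows /= rmorph0 rmorph1.
- case: g => /= *;
    by rewrite ?map_white_mx ?map_black_mx ?map_hbox_mx ?map_mx_of_rows /=
               ?rmorphN ?rmorph0 ?rmorph1.
- by rewrite map_mxM IH2 IH1.
- by rewrite map_castmx map_mxT IH1 IH2.
Qed.

End MapDiagram.

(** * Total degrees of the matrix entries *)

Section Degree.
Variables (R : idomainType) (n : nat).
Implicit Types (p q : {mpoly R[n]}) (s t : nat).

(** [msize] is the total degree plus one, and 0 at the zero polynomial, which therefore satisfies
    every bound. *)
Definition deg_le s p := (msize p <= s.+1)%N.
Definition mx_deg_le s a b (M : 'M[{mpoly R[n]}]_(a, b)) :=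
  forall i j, deg_le s (M i j).

Lemma deg_le_weaken s t p : (s <= t)%N -> deg_le s p -> deg_le t p.
Proof. by move=> le_st /leq_trans; apply. Qed.

Lemma deg_leC s c : deg_le s c%:MP.
Proof. by rewrite /deg_le msizeC; case: eqP. Qed.

Lemma deg_le0 s : deg_le s 0.
Proof. by rewrite -mpolyC0 deg_leC. Qed.

Lemma deg_leD s p q : deg_le s p -> deg_le s q -> deg_le s (p + q).
Proof. by move=> ps qs; apply: leq_trans (msizeD_le _ _) _; rewrite geq_max; apply/andP. Qed.

Lemma deg_leN s p : deg_le s (- p) = deg_le s p.
Proof. by rewrite /deg_le msizeN. Qed.

Lemma deg_leM s t p q : deg_le s p -> deg_le t q -> deg_le (s + t) (p * q).
Proof.
have [->|nz_p] := eqVneq p 0; first by move=> _ _; rewrite mul0r deg_le0.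
have [->|nz_q] := eqVneq q 0; first by move=> _ _; rewrite mulr0 deg_le0.
move=> ps qt; rewrite /deg_le msizeM // -subn1 leq_subLR.
by apply: leq_trans (leq_add ps qt) _; rewrite addSn addnS.
Qed.

Lemma deg_le_sum s I r (P : pred I) (G : I -> {mpoly R[n]}) :
  (forall i, P i -> deg_le s (G i)) -> deg_le s (\sum_(i <- r | P i) G i).
Proof.
move=> GsP; apply: (big_ind (deg_le s)) => //; first exact: deg_le0.
exact: deg_leD.
Qed.

Lemma mx_deg_leM s t a b c (M : 'M_(a, b)) (N : 'M_(b, c)) :
  mx_deg_le s M -> mx_deg_le t N -> mx_deg_le (s + t) (M *m N).
Proof. by move=> Ms Nt i j; rewrite mxE; apply: deg_le_sum => l _; apply: deg_leM. Qed.

Lemma mx_deg_le_rows s a b (rows : seq (seq {mpoly R[n]})) :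
  all (all (deg_le s)) rows -> mx_deg_le s (mx_of_rows a b rows).
Proof.
move=> /(all_nthP [::]) rows_s i j; rewrite mxE.
have [lt_i|le_i] := ltnP i (size rows); last first.
  by rewrite (nth_default [::]) // nth_nil deg_le0.
have [lt_j|le_j] := ltnP j (size (nth [::] rows i)).
  exact: (all_nthP 0 (rows_s _ lt_i)).
by rewrite (nth_default 0) // deg_le0.
Qed.

Lemma mx_deg_le_ket s a b :
  mx_deg_le s (@ket {mpoly R[n]} a b).
Proof. by move=> i j; rewrite mxE -mpolyC_nat deg_leC. Qed.

Lemma mx_deg_le_ketbra a b (u : a.-tuple bool) (v : b.-tuple bool) :
  mx_deg_le 0 (ket {mpoly R[n]} u *m (ket {mpoly R[n]} v)^T).
Proof.
apply: (mx_deg_leM (s := 0) (t := 0)); first exact: mx_deg_le_ket.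
by move=> i j; rewrite mxE; apply: mx_deg_le_ket.
Qed.

Lemma mx_deg_leZ s a b p (M : 'M_(a, b)) :
  deg_le s p -> mx_deg_le 0 M -> mx_deg_le s (p *: M).
Proof. by move=> ps M0 i j; rewrite mxE -[s]addn0; apply: deg_leM. Qed.

Lemma mx_deg_leD s a b (M N : 'M_(a, b)) :
  mx_deg_le s M -> mx_deg_le s N -> mx_deg_le s (M + N).
Proof. by move=> Ms Ns i j; rewrite mxE; apply: deg_leD. Qed.

Lemma mx_deg_le_sum s a b I r (P : pred I) (G : I -> 'M_(a, b)) :
  (forall i, P i -> mx_deg_le s (G i)) -> mx_deg_le s (\sum_(i <- r | P i) G i).
Proof.
move=> GsP; apply: (big_ind (@mx_deg_le s a b)) => //; last by move=> M N; apply: mx_deg_leD.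
by move=> i j; rewrite mxE deg_le0.
Qed.

Lemma mx_deg_le_white s a b p : deg_le s p -> mx_deg_le s (white_mx a b p).
Proof.
move=> ps; apply: mx_deg_leD; last exact/mx_deg_leZ/mx_deg_le_ketbra.
by move=> i j; apply/deg_le_weaken/mx_deg_le_ketbra.
Qed.

(** The exponent of the label is a product of bits, hence 0 or 1. *)
Lemma mx_deg_le_hbox s a b p : deg_le s p -> mx_deg_le s (hbox_mx a b p).
Proof.
move=> ps; apply: mx_deg_le_sum => u _; apply: mx_deg_le_sum => v _.
apply: mx_deg_leZ; last exact: mx_deg_le_ketbra.
have: (\prod_(k < a) tnth u k * \prod_(k < b) tnth v k <= 1)%N.
  have le1 l (w : l.-tuple bool) : (\prod_(k < l) tnth w k <= 1)%N.
    by apply: (big_ind (leq^~ 1)) => // [x y|i _]; [apply: (@leq_mul x y 1 1) | case: (tnth w i)].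
  exact: (@leq_mul _ _ 1 1).
by case: (_ * _)%N => [|[|]] // _; rewrite ?expr0 ?expr1 -?mpolyC1 ?deg_leC.
Qed.

Definition phase_degree k a b (D : diagram {mpoly R[n]} k a b) :=
  (\sum_(p <- dphases D) (msize p).-1)%N.

(** Each generator has entries of degree at most one in its phase, while composition and tensor
    product multiply entries; so every occurrence of a phase adds its degree once. *)
Lemma mx_deg_le_interp k a b (D : diagram {mpoly R[n]} k a b) :
  mx_deg_le (phase_degree D) (interp D).
Proof.
rewrite /phase_degree.
have d0 s : deg_le s 0 := deg_le0 s; have d1 s : deg_le s 1 := deg_leC s 1.
have dN1 s : deg_le s (- 1) by rewrite deg_leN.
have mx1 s m : mx_deg_le s (1%:M : 'M_m).
  by move=> i j; rewrite mxE; case: (i == j).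
have deg_msize p : deg_le (msize p).-1 p by apply: leqSpred.
elim: D => [|||||n' m' g|n' m' l D2 IH2 D1 IH1|n1 m1 n2 m2 D1 IH1 D2 IH2] /=.
1-2: exact: mx1.
1-3: by apply: mx_deg_le_rows; rewrite /= ?d0 ?d1.
- case: g => [p|||n2 m2 p|n2||n2 m2|n2 m2 p] /=; rewrite ?big_seq1.
  + by apply: mx_deg_le_rows; rewrite /= d1 deg_msize.
  + by apply: mx_deg_le_rows; rewrite /= ?d0 ?d1.
  + by apply: mx_deg_le_rows; rewrite /= ?d0 ?d1.
  + exact: mx_deg_le_white.
  + by apply: mx_deg_le_sum => i _; apply: mx_deg_le_ket.
  + by apply: mx_deg_le_rows; rewrite /= ?d0 ?d1 ?dN1.
  + exact: mx_deg_le_white.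
  + exact: mx_deg_le_hbox.
- by rewrite big_cat; apply: mx_deg_leM.
- move=> i j; rewrite big_cat castmxE mxE; exact: deg_leM.
Qed.

End Degree.

(** * Kronecker substitution *)

(** Horner's scheme for the number with base-[B] digits [s], least significant first. *)
Definition kronecker_exponent (B : nat) (s : seq nat) : nat :=
  foldr (fun e k => e + k * B)%N 0%N s.

Lemma kronecker_exponent_lt B s :
  all (fun e => e < B)%N s -> (kronecker_exponent B s < B ^ size s)%N.
Proof.
elim: s => //= e s IHs /andP[lt_eB /IHs lt_s].
rewrite expnSr; apply: leq_trans (_ : (kronecker_exponent B s).+1 * B <= _)%N.
  by rewrite mulSn ltn_add2r.
by rewrite leq_mul2r lt_s orbT.
Qed.

(** Uniqueness of base-[B] digits: the remainder modulo [B] gives the head, the quotient gives the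
    tail. *)
Lemma kronecker_exponent_inj B s t : size s = size t ->
  all (fun e => e < B)%N s -> all (fun e => e < B)%N t ->
  kronecker_exponent B s = kronecker_exponent B t -> s = t.
Proof.
elim: s t => [|e s IHs] [|f t] //= [eq_st] /andP[eB sB] /andP[fB tB] eq_k.
have B_gt0 : (0 < B)%N by apply: leq_ltn_trans eB.
move: eq_k; rewrite ![(_ + _ * B)%N]addnC => eq_k.
have := congr1 (modn^~ B) eq_k; rewrite !modnMDl !modn_small // => eq_ef.
have := congr1 (divn^~ B) eq_k.
by rewrite !divnMDl // !divn_small // !addn0 eq_ef => /IHs->.
Qed.

Lemma kronecker_exponentE B n (m : 'X_{1..n}) :
  kronecker_exponent B m = (\sum_(i < n) m i * B ^ i)%N.
Proof.
have Ek s : kronecker_exponent B s = (\sum_(i < size s) nth 0 s i * B ^ i)%N.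
  elim: s => [|e s IHs] /=; first by rewrite big_ord0.
  rewrite big_ord_recl /= muln1 IHs big_distrl; congr addn.
  by apply: eq_bigr => i _; rewrite /= -mulnA -expnSr.
rewrite Ek size_tuple; apply: eq_bigr => i _.
by rewrite (mnm_nth 0).
Qed.

Lemma mdeg_lt_all n (m : 'X_{1..n}) B :
  (mdeg m < B)%N -> all (fun e => e < B)%N m.
Proof.
move=> lt_mB; apply/allP=> e /tnthP[i ->]; apply: leq_ltn_trans lt_mB.
by rewrite -mnm_tnth mdegE (bigD1 i) //= leq_addr.
Qed.

Section Kronecker.
Variables (F : fieldType) (n B : nat).
Implicit Type P : {mpoly F[n]}.

(** The image of [P] when the [i]-th variable is replaced by the [B ^ i]-th power of a single
    one. *)
Definition kronecker_poly P : {poly F} :=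
  \sum_(m <- msupp P) P@_m *: 'X^(kronecker_exponent B m).

(** When all exponents are below [B], distinct monomials go to distinct powers, so no coefficients
    cancel. *)
Lemma kronecker_poly_neq0 P :
  (msize P <= B)%N -> P != 0 -> kronecker_poly P != 0.
Proof.
move=> szP nz_P; apply/eqP => K0.
have suppB m : m \in msupp P -> all (fun e => e < B)%N m.
  by move=> mP; apply/mdeg_lt_all/(leq_trans (msize_mdeg_lt mP)).
case/negP: nz_P; apply/eqP/mpolyP => m; rewrite mcoeff0.
apply/eqP; rewrite mcoeff_eq0; apply/negP => mP.
have := congr1 (fun q : {poly F} => q`_(kronecker_exponent B m)) K0.
rewrite coef0 coef_sum (bigD1_seq m) ?msupp_uniq //= coefZ coefXn eqxx mulr1.
rewrite big_seq_cond big1 ?addr0 => [/eqP|l /andP[lP neq_lm]].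
  by rewrite mcoeff_eq0 mP.
rewrite coefZ coefXn; case: eqP => [/kronecker_exponent_inj eq_ml|_]; last by rewrite mulr0.
case/eqP: neq_lm; apply/esym/val_inj/val_inj/eq_ml; rewrite ?suppB //.
by rewrite !size_tuple.
Qed.

Lemma size_kronecker_poly P :
  (msize P <= B)%N -> (size (kronecker_poly P) <= B ^ n)%N.
Proof.
move=> szP; rewrite /kronecker_poly big_seq.
apply: (big_ind (fun q : {poly F} => size q <= B ^ n)%N).
- by rewrite size_poly0.
- by move=> p q sp sq; rewrite (leq_trans (size_polyD _ _)) // geq_max sp.
move=> m mP; apply: leq_trans (size_scale_leq _ _) _; rewrite size_polyXn.
have := kronecker_exponent_lt (mdeg_lt_all (leq_trans (msize_mdeg_lt mP) szP)).
by rewrite size_tuple.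
Qed.

Lemma meval_kronecker (L : fieldType) (iota : {rmorphism F -> L}) (z : L) P :
  meval (fun i : 'I_n => z ^+ (B ^ i)) (map_mpoly iota P)
    = (map_poly iota (kronecker_poly P)).[z].
Proof.
have eval_term c m :
    meval (fun i : 'I_n => z ^+ (B ^ i)) (map_mpoly iota (c *: 'X_[m]))
      = (map_poly iota (c *: 'X^(kronecker_exponent B m))).[z].
  rewrite map_mpolyZ map_mpolyX mevalZ mevalX map_polyZ map_polyXn hornerZ.
  rewrite hornerXn kronecker_exponentE -prodrXr; congr (_ * _).
  by apply: eq_bigr => i _; rewrite -exprM mulnC.
rewrite {1}[P]mpolyE (rmorph_sum (map_mpoly iota)) (rmorph_sum (meval _)).
rewrite (rmorph_sum (map_poly iota)) horner_sum.
by apply: eq_bigr => m _; apply: eval_term.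
Qed.

End Kronecker.

Lemma lift_mpoly (F L : fieldType) (iota : {rmorphism F -> L}) n
    (p : {mpoly L[n]}) :
  (forall m, m \in msupp p -> in_image iota p@_m) ->
  exists q : {mpoly F[n]}, map_mpoly iota q = p.
Proof.
move=> pF.
have [g gK] : exists g : 'X_{1..n} -> F, forall m, m \in msupp p -> iota (g m) = p@_m.
  have /boolp.choice[g gK] : forall m, exists x, m \in msupp p -> iota x = p@_m.
    move=> m; case mp: (m \in msupp p); last by exists 0.
    by have [x xm] := pF m mp; exists x.
  by exists g.
exists (\sum_(m <- msupp p) g m *: 'X_[m]).
rewrite (rmorph_sum (map_mpoly iota)) [RHS]mpolyE.
apply: eq_big_seq => m mp; rewrite -gK //.
by rewrite -(map_mpolyX iota m); apply: map_mpolyZ.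
Qed.

Lemma msize_map_mpoly (F L : fieldType) (iota : {rmorphism F -> L}) n
    (p : {mpoly F[n]}) :
  msize (map_mpoly iota p) = msize p.
Proof.
by rewrite !msizeE; apply/perm_big/msupp_map_mpoly/fmorph_inj.
Qed.

(** * A single verifying instance *)

Section SingleInstance.
Variables (L : numFieldType) (k : calculus) (n : nat).
Variable E : equation {mpoly L[n]} k.
Variables (d B N : nat) (z : L).
Hypothesis algebraic_constants : forall c, c \in phase_constants E ->
  exists p : {poly rat},
    [/\ p != 0, root (map_poly ratr p) c & ((size p).-1 <= d)%N].
Hypotheses (N_gt0 : (0 < N)%N) (zN2 : z ^+ N = 2).
Hypothesis degree_B : (\sum_(p <- ephases E) (msize p).-1 < B)%N.
Hypothesis N_large : (d ^ size (phase_constants E) * (B ^ n).-1 < N)%N.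

Lemma sound_of_instance :
  sound_closed (instantiate (fun i : 'I_n => z ^+ (B ^ i)) E) -> sound E.
Proof.
have [F [iota [dimF constF]]] := number_field algebraic_constants.
(* All coefficients of the phases lie in the image of [iota], so the phases descend to [F]. *)
have [g gK] : exists g : {mpoly L[n]} -> {mpoly F[n]},
    {in ephases E, forall p, map_mpoly iota (g p) = p}.
  have /boolp.choice[g gK] : forall p, exists q : {mpoly F[n]},
      p \in ephases E -> map_mpoly iota q = p.
    move=> p; case Ep: (p \in ephases E); last by exists 0.
    have [|q qp] := @lift_mpoly F L iota n p; last by exists q.
    move=> m mp; apply/constF/flattenP; exists [seq p@_m | m <- msupp p].
      by apply/mapP; exists p.
    exact: map_f.
  by exists g.
(* [g] is a section of [map_mpoly iota] only on the phases of [E], and [dmap] meets no others. *)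
have lhsE : lhs E = dmap (map_mpoly iota) (dmap g (lhs E)).
  rewrite dmap_comp -[LHS]dmap_id; apply: eq_in_dmap => p Ep /=.
  by rewrite gK // mem_cat Ep.
have rhsE : rhs E = dmap (map_mpoly iota) (dmap g (rhs E)).
  rewrite dmap_comp -[LHS]dmap_id; apply: eq_in_dmap => p Ep /=.
  by rewrite gK // mem_cat Ep orbT.
have sum_msize (s : seq {mpoly L[n]}) : {subset s <= ephases E} ->
    (\sum_(p <- map g s) (msize p).-1 = \sum_(p <- s) (msize p).-1)%N.
  move=> sE; rewrite big_map; apply: eq_big_seq => p /sE Ep.
  by rewrite -(msize_map_mpoly iota) gK.
set D1 := dmap g (lhs E) in lhsE; set D2 := dmap g (rhs E) in rhsE.
have degD1 : (phase_degree D1 <= \sum_(p <- ephases E) (msize p).-1)%N.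
  rewrite /phase_degree dphases_dmap sum_msize; last first.
    by move=> p Ep; rewrite mem_cat Ep.
  by rewrite /ephases big_cat leq_addr.
have degD2 : (phase_degree D2 <= \sum_(p <- ephases E) (msize p).-1)%N.
  rewrite /phase_degree dphases_dmap sum_msize; last first.
    by move=> p Ep; rewrite mem_cat Ep orbT.
  by rewrite /ephases big_cat leq_addl.
rewrite /sound_closed /instantiate /emap /= => eqE.
(* Evaluation and [map_mpoly iota] are ring morphisms, so equality of the polynomial matrices over
   [F] yields every instance. *)
suffices eqD : interp D1 = interp D2.
  by move=> a; rewrite /sound_closed /= lhsE rhsE -!map_interp eqD.
apply/matrixP=> i j; apply/eqP; rewrite -subr_eq0; apply/negPn/negP => nzP.
set P := _ - _ in nzP.
have szP : (msize P <= B)%N.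
  apply: leq_trans degree_B; apply: deg_leD; rewrite ?deg_leN.
    exact: deg_le_weaken degD1 (mx_deg_le_interp D1 i j).
  exact: deg_le_weaken degD2 (mx_deg_le_interp D2 i j).
(* A size of at most [B ^ n] means a degree of at most [(B ^ n).-1]. *)
have lt_N : (\dim {:F} * (size (kronecker_poly B P)).-1 < N)%N.
  apply: leq_ltn_trans N_large; apply: leq_mul => //.
  by rewrite -!subn1 leq_sub2r // size_kronecker_poly.
have nzK := kronecker_poly_neq0 szP nzP.
(* It remains to see that [z] is a root: at the given instance the two entries agree. *)
case/negP: (root_two_not_root iota N_gt0 zN2 nzK lt_N).
rewrite rootE -meval_kronecker /P !rmorphB /= subr_eq0.
move/matrixP/(_ i j)/eqP: eqE; rewrite {1}lhsE {1}rhsE -!map_interp !mxE.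
by [].
Qed.

End SingleInstance.

(** * Computability of the substitution *)

(** [computable] is a predicate on functions themselves; functional extensionality makes it respect
    pointwise equality. *)
Lemma eq_computable f g : f =1 g -> computable f -> computable g.
Proof. by move=> /boolp.funext->. Qed.

Lemma computable_const t : computable (fun _ => t).
Proof. by elim: t => [|t IHt u IHu]; [apply: computable_leaf | apply: computable_node]. Qed.

Definition computable2 (f : tree -> tree -> tree) :=
  computable (fun z => f (tfst z) (tsnd z)).

Lemma computable2_comp f a b : computable2 f -> computable a -> computable b ->
  computable (fun x => f (a x) (b x)).
Proof. by move=> cf ca cb; apply: (computable_comp cf (computable_node ca cb)). Qed.

(** This recognises a structural fixpoint by its two equations; the pairing of the arguments of [h]
    is the one used by [primrec]. *)
Lemma computable_rec f g h :
  (forall x, f x Leaf = g x) ->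
  (forall x a b, f x (Node a b) = h x (Node a b) (f x a) (f x b)) ->
  computable g ->
  computable (fun z => h (tfst z) (tfst (tsnd z)) (tfst (tsnd (tsnd z)))
                         (tsnd (tsnd (tsnd z)))) ->
  computable2 f.
Proof.
move=> f0 fS cg /(computable_primrec cg); apply: eq_computable => z.
elim: (tsnd z) => [|a IHa b IHb] /=; first by rewrite f0.
by rewrite IHa IHb fS.
Qed.

Definition if_leaf c (t u : tree) := if c is Leaf then t else u.

(** Case distinction is a primitive recursion that ignores the recursive values. *)
Lemma computable_if c f g : computable c -> computable f -> computable g ->
  computable (fun x => if_leaf (c x) (f x) (g x)).
Proof.
move=> cc cf cg; apply: (computable2_comp (f := fun x t => if_leaf t (f x) (g x)) _ (computable_id) cc).
apply: (@computable_rec _ f (fun x _ _ _ => g x)) => //.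
exact: computable_comp cg computable_fst.
Qed.

(** Binary functions are split off by [computable2_comp], and [assumption] then closes their
    computability. For this purpose the proofs below first put such facts into the context. *)
Ltac solve_computable := rewrite /code /=; repeat first
  [ assumption | exact: computable_id | exact: computable_const
  | apply: computable_node | apply: computable_if
  | apply: (computable_comp computable_fst)
  | apply: (computable_comp computable_snd)
  | apply: computable2_comp ].

(** Arithmetic on the unary numerals [tnat n], where the number is the length of the right spine. *)
Fixpoint tadd x t := if t is Node _ u then Node Leaf (tadd x u) else x.
Fixpoint tmul x t := if t is Node _ u then tadd x (tmul x u) else Leaf.
Fixpoint texp x t := if t is Node _ u then tmul x (texp x u) else tnat 1.
Fixpoint tree_size t := if t is Node u v then (tree_size u + tree_size v).+1 else 1%N.

Fixpoint unary_size t :=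
  if t is Node u v then Node Leaf (tadd (unary_size u) (unary_size v)) else tnat 1.

Lemma tadd_tnat m n : tadd (tnat m) (tnat n) = tnat (m + n).
Proof. by elim: n => [|n /= ->]; rewrite ?addn0 ?addnS. Qed.

Lemma tmul_tnat m n : tmul (tnat m) (tnat n) = tnat (m * n).
Proof. by elim: n => [|n /= ->]; rewrite ?muln0 // tadd_tnat mulnS. Qed.

Lemma texp_tnat m n : texp (tnat m) (tnat n) = tnat (m ^ n).
Proof. by elim: n => [|n /= ->] //; rewrite tmul_tnat expnS. Qed.

Lemma unary_sizeE t : unary_size t = tnat (tree_size t).
Proof. by elim: t => [|u /= -> v ->] //; rewrite tadd_tnat. Qed.

Lemma computable_tadd : computable2 tadd.
Proof. by apply: (@computable_rec _ id (fun _ _ _ r => Node Leaf r)) => //; solve_computable. Qed.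

Lemma computable_tmul : computable2 tmul.
Proof.
have := computable_tadd => cadd.
by apply: (@computable_rec _ (fun=> Leaf) (fun x _ _ r => tadd x r)) => //; solve_computable.
Qed.

Lemma computable_texp : computable2 texp.
Proof.
have := computable_tmul => cmul.
by apply: (@computable_rec _ (fun=> tnat 1) (fun x _ _ r => tmul x r)) => //; solve_computable.
Qed.

Lemma computable_unary_size : computable unary_size.
Proof.
have cadd := computable_tadd.
have c2 : computable2 (fun _ t => unary_size t).
  by apply: (@computable_rec _ (fun=> tnat 1) (fun _ _ r s => Node Leaf (tadd r s))) => //;
    solve_computable.
exact: computable2_comp c2 computable_id computable_id.
Qed.

(* A pair [p = Node cB cz] holds the codes of the base [B] and of the radical
   [z] whose powers are substituted for the variables. *)
Fixpoint subst_monomial_code p l :=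
  if l is Node e l' then
    code 3 [:: code 6 [:: tsnd p; e];
               code 6 [:: subst_monomial_code p l'; tfst p]]
  else code 1 [:: tnat 1].

Fixpoint subst_npoly_code p s :=
  if s is Node t s' then
    code 2 [:: code 3 [:: code 0 [:: tfst t]; subst_monomial_code p (tsnd t)];
               subst_npoly_code p s']
  else code 1 [:: tnat 0].

(* In the code of a generator the phase, if any, is the last argument. *)
Fixpoint subst_last_code p s :=
  if s is Node t s' then
    if_leaf s' (Node (subst_npoly_code p t) Leaf) (Node t (subst_last_code p s'))
  else Leaf.

(* The [j]-fold [tsnd] of [tnat g] is a leaf iff [g <= j].  The tags 4 to 6 have
   no phase, and neither have 1 and 2, but their argument lists are empty. *)
Definition subst_generator_code p t :=
  Node (tfst t)
    (if_leaf (tsnd (tsnd (tsnd (tfst t)))) (subst_last_code p (tsnd t))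
    (if_leaf (tsnd (tsnd (tsnd (tsnd (tsnd (tsnd (tfst t))))))) (tsnd t)
             (subst_last_code p (tsnd t)))).

Fixpoint subst_generators_code p s :=
  if s is Node t s' then
    Node (subst_generator_code p t) (subst_generators_code p s')
  else Leaf.

(* The two components treat the tree as the code of a diagram and as that of a
   list of diagrams. *)
Fixpoint subst_diagram_codes p t :=
  if t is Node u v then
    Node
      (Node u (if_leaf (tsnd (tsnd (tsnd (tsnd (tsnd u)))))
                 (subst_generators_code p v) (tsnd (subst_diagram_codes p v))))
      (Node (tfst (subst_diagram_codes p u)) (tsnd (subst_diagram_codes p v)))
  else Node Leaf Leaf.

Definition subst_equation_code p t :=
  Node (tfst (subst_diagram_codes p (tfst t)))
       (tfst (subst_diagram_codes p (tsnd t))).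

Definition root_two N := NRoot N (NNat 2).

(** The numbers [n] and [d] enter only through the size of the input, whose third entry is the
    equation. The second component of [p] is the code of [root_two (B ^ B)]. *)
Definition construct t :=
  let B := unary_size t in
  let p := Node B (code 7 [:: texp B B; code 1 [:: tnat 2]]) in
  subst_equation_code p (tfst (tsnd (tsnd t))).

Lemma computable_subst_equation_code : computable2 subst_equation_code.
Proof.
have cmon : computable2 subst_monomial_code.
  by apply: (@computable_rec _ (fun=> code 1 [:: tnat 1]) (fun p t _ r =>
      code 3 [:: code 6 [:: tsnd p; tfst t]; code 6 [:: r; tfst p]])) => //;
    solve_computable.
have cpoly : computable2 subst_npoly_code.
  by apply: (@computable_rec _ (fun=> code 1 [:: tnat 0]) (fun p t _ r =>
      code 2 [:: code 3 [:: code 0 [:: tfst (tfst t)];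
                            subst_monomial_code p (tsnd (tfst t))]; r])) => //;
    solve_computable.
have clast : computable2 subst_last_code.
  by apply: (@computable_rec _ (fun=> Leaf) (fun p t _ r =>
      if_leaf (tsnd t) (Node (subst_npoly_code p (tfst t)) Leaf)
              (Node (tfst t) r))) => //;
    solve_computable.
have cgen : computable2 subst_generator_code.
  by rewrite /computable2 /subst_generator_code; solve_computable.
have cgens : computable2 subst_generators_code.
  by apply: (@computable_rec _ (fun=> Leaf) (fun p t _ r =>
      Node (subst_generator_code p (tfst t)) r)) => //;
    solve_computable.
have cdiag : computable2 subst_diagram_codes.
  by apply: (@computable_rec _ (fun=> Node Leaf Leaf) (fun p t r s => Node
      (Node (tfst t) (if_leaf (tsnd (tsnd (tsnd (tsnd (tsnd (tfst t))))))
                        (subst_generators_code p (tsnd t)) (tsnd s)))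
      (Node (tfst r) (tsnd s)))) => //;
    solve_computable.
by rewrite /computable2 /subst_equation_code; solve_computable.
Qed.

Lemma computable_construct : computable construct.
Proof.
have csubst := computable_subst_equation_code.
have csize := computable_unary_size; have cexp := computable_texp.
have cpair : computable (fun t => Node (unary_size t)
    (code 7 [:: texp (unary_size t) (unary_size t); code 1 [:: tnat 2]])).
  by solve_computable.
by apply: computable2_comp csubst cpair _; solve_computable.
Qed.

(** * Correctness of the substitution on codes and on values *)

Section Substitution.
Variables (B : nat) (z : radical).

(** The same Horner scheme as in [kronecker_exponent]: repeated powers with exponent [B] produce the
    powers [B ^ i] without writing them down, and the recursion follows the code of the exponent
    list. *)
Definition subst_monomial (l : seq nat) : radical :=
  foldr (fun e r => NMul (NExp z e) (NExp r B)) (NNat 1) l.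

Definition subst_npoly n (s : named_poly n) : radical :=
  foldr (fun (t : nat * 'X_{1..n}) r =>
           NAdd (NMul (NConst t.1) (subst_monomial t.2)) r) (NNat 0) s.

Let p := Node (tnat B) (code_radical z).

Lemma code_subst_monomial l :
  subst_monomial_code p (tlist [seq tnat e | e <- l])
    = code_radical (subst_monomial l).
Proof. by elim: l => //= e l ->. Qed.

Lemma code_subst_npoly n (s : named_poly n) :
  subst_npoly_code p (code_npoly s) = code_radical (subst_npoly s).
Proof.
rewrite /code_npoly; elim: s => //= t s ->.
by rewrite code_subst_monomial.
Qed.

Lemma code_subst_generator k n a b (g : generator (named_poly n) k a b) :
  subst_generator_code p (code_generator (@code_npoly n) g)
    = code_generator code_radical (gmap (@subst_npoly n) g).
Proof. by case: g => *; rewrite /subst_generator_code /= ?code_subst_npoly. Qed.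

Lemma code_subst_diagram k n a b (D : diagram (named_poly n) k a b) :
  tfst (subst_diagram_codes p (code_diagram (@code_npoly n) D))
    = code_diagram code_radical (dmap (@subst_npoly n) D).
Proof.
elim: D => //= [n' m' g|n' m' l D2 IH2 D1 IH1|n1 m1 n2 m2 D1 IH1 D2 IH2].
- by rewrite code_subst_generator.
- by rewrite IH1 IH2.
- by rewrite IH1 IH2.
Qed.

Variables (L : numClosedFieldType) (rho : nat -> L).

Lemma radical_val_monomial l :
  radical_val rho (subst_monomial l) = radical_val rho z ^+ kronecker_exponent B l.
Proof. by elim: l => //= e l ->; rewrite exprD exprM. Qed.

Lemma radical_val_npoly n (s : named_poly n) :
  radical_val rho (subst_npoly s)
    = meval (fun i : 'I_n => radical_val rho z ^+ (B ^ i)) (npoly_val rho s).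
Proof.
rewrite /npoly_val; elim: s => [|t s IHs] /=; first by rewrite big_nil meval0.
rewrite big_cons mevalD mevalZ mevalX IHs radical_val_monomial.
rewrite kronecker_exponentE -prodrXr; congr (_ * _ + _).
by apply: eq_bigr => i _; rewrite -exprM mulnC.
Qed.

End Substitution.

Lemma code_construct k n d (S : equation (named_poly n) k) :
  let t := tlist [:: tnat n; tnat d; code_equation (@code_npoly n) S] in
  let B := tree_size t in
  construct t
    = code_equation code_radical
        (emap (@subst_npoly B (root_two (B ^ B)) n) S).
Proof.
move=> t B; rewrite /construct unary_sizeE texp_tnat /code_equation /=.
by rewrite -!code_subst_diagram.
Qed.

(** Counting each term with its degree plus one bounds both the number of terms and the total
    degree. *)
Definition npoly_weight n (s : named_poly n) : nat :=
  (\sum_(t <- s) (mdeg t.2).+1)%N.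

Lemma tree_size_tnat n : (n < tree_size (tnat n))%N.
Proof. by elim: n => //= n IHn; rewrite ltnS (leq_trans IHn) ?leq_addl. Qed.

Lemma tree_size_npoly n (s : named_poly n) :
  (npoly_weight s <= tree_size (code_npoly s))%N.
Proof.
rewrite /npoly_weight /code_npoly; elim: s => [|t s IHs]; first by rewrite big_nil.
rewrite big_cons /= addSn ltnS leq_add //.
have le_deg l : (\sum_(e <- l) e <= tree_size (tlist [seq tnat e | e <- l]))%N.
  elim: l => [|e l IHl]; first by rewrite big_nil.
  by rewrite big_cons /= leqW // leq_add // ltnW ?tree_size_tnat.
by rewrite leqW // (leq_trans (le_deg t.2)) ?leq_addl.
Qed.

(** The codes of the phases are disjoint subtrees of the code of the diagram. *)
Lemma tree_size_diagram (P : Type) (c : P -> tree) k a b (D : diagram P k a b) :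
  (\sum_(s <- dphases D) tree_size (c s) <= tree_size (code_diagram c D))%N.
Proof.
elim: D => [|||||n' m' g|n' m' l D2 IH2 D1 IH1|n1 m1 n2 m2 D1 IH1 D2 IH2] /=;
  rewrite ?big_nil ?big_cat //=; try lia.
by case: g => * /=; rewrite ?big_seq1 ?big_nil //=; lia.
Qed.

(** This single inequality supplies every bound on the base [B]. *)
Lemma tree_size_input k n d (S : equation (named_poly n) k) :
  (n + d + \sum_(s <- ephases S) npoly_weight s
     < tree_size (tlist [:: tnat n; tnat d; code_equation (@code_npoly n) S]))%N.
Proof.
have le_weight (r : seq (named_poly n)) :
    (\sum_(s <- r) npoly_weight s <= \sum_(s <- r) tree_size (code_npoly s))%N.
  by apply: leq_sum => s _; apply: tree_size_npoly.
have := leq_trans (le_weight _) (tree_size_diagram (@code_npoly n) (lhs S)).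
have := leq_trans (le_weight _) (tree_size_diagram (@code_npoly n) (rhs S)).
have := tree_size_tnat n; have := tree_size_tnat d.
rewrite /ephases big_cat /=; lia.
Qed.

Section NamedPolynomials.
Variables (L : idomainType) (rho : nat -> L) (n : nat).
Implicit Type s : named_poly n.

Lemma msize_npoly_val s : ((msize (npoly_val rho s)).-1 <= npoly_weight s)%N.
Proof.
suffices: deg_le (npoly_weight s) (npoly_val rho s) by rewrite -subn1 leq_subLR.
rewrite /npoly_val /npoly_weight; elim: s => [|t s IHs].
  by rewrite !big_nil deg_le0.
rewrite !big_cons; apply: deg_leD; last exact: deg_le_weaken (leq_addl _ _) IHs.
apply: leq_trans (msizeZ_le _ _) _; rewrite msizeX.
by rewrite leqW // leq_addr.
Qed.

(** Terms of [s] may merge or cancel in the polynomial, but every monomial of the support comes from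
    some term. *)
Lemma size_msupp_npoly_val s :
  (size (msupp (npoly_val rho s)) <= npoly_weight s)%N.
Proof.
apply: (@leq_trans (size [seq t.2 | t <- s])).
  apply: uniq_leq_size (msupp_uniq _) _ => m.
  rewrite /npoly_val; elim: s => [|t s IHs]; first by rewrite big_nil msupp0.
  rewrite big_cons => /msuppD_le; rewrite mem_cat => /orP[/msuppZ_le|/IHs].
    by rewrite msuppX !inE => ->.
  by rewrite inE orbC => ->.
rewrite size_map /npoly_weight -sum1_size; exact: leq_sum.
Qed.

Lemma size_phase_constants k (S : equation (named_poly n) k) :
  (size (phase_constants (emap (@npoly_val _ rho n) S))
     <= \sum_(s <- ephases S) npoly_weight s)%N.
Proof.
rewrite /phase_constants size_flatten /shape -map_comp sumnE big_map.
rewrite /ephases !dphases_dmap -map_cat big_map.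
by apply: leq_sum => s _; rewrite /= size_map size_msupp_npoly_val.
Qed.

Lemma degree_phases k (S : equation (named_poly n) k) :
  (\sum_(p <- ephases (emap (@npoly_val _ rho n) S)) (msize p).-1
     <= \sum_(s <- ephases S) npoly_weight s)%N.
Proof.
rewrite /ephases !dphases_dmap -map_cat big_map.
by apply: leq_sum => s _; apply: msize_npoly_val.
Qed.

End NamedPolynomials.

(** Bound [d ^ c] by [B ^ c]; strictness comes from the predecessor of [B ^ n], and [c + n <= B]
    absorbs the product into [B ^ B]. *)
Lemma exp_bound (B c d n : nat) : (d <= B)%N -> (0 < B)%N -> (c + n <= B)%N ->
  (d ^ c * (B ^ n).-1 < B ^ B)%N.
Proof.
move=> le_dB B_gt0 le_cnB.
apply: (@leq_trans (B ^ c * B ^ n)); last by rewrite -expnD leq_pexp2l.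
apply: (@leq_ltn_trans (B ^ c * (B ^ n).-1)).
  by apply: leq_mul => //; case: c {le_cnB} => [|c] //; rewrite leq_exp2r.
by rewrite ltn_pmul2l ?expn_gt0 ?B_gt0 // prednK // expn_gt0 B_gt0.
Qed.

Theorem theorem8p33 (R : realType) (k : calculus) :
  (forall (n : nat) (E : equation {mpoly R[i][n]} k),
     exists F : equation R[i] k,
       verifies (single F) E /\ instance_of F E)
  /\
  (exists2 construct : tree -> tree, computable construct &
     forall (n d : nat) (S : equation (named_poly n) k),
     exists T : equation radical k,
       construct (tlist [:: tnat n; tnat d; code_equation (@code_npoly n) S])
         = code_equation code_radical T
       /\
       forall rho : nat -> R[i],
         let E : equation {mpoly R[i][n]} k := emap (@npoly_val _ rho n) S in
         let F : equation R[i] k := emap (radical_val rho) T in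
         (forall c, c \in phase_constants E ->
            exists2 p : {poly rat},
              minimal_polynomial c p & ((size p).-1 <= d)%N) ->
         verifies (single F) E /\ instance_of F E).
Proof.
split=> [n E|].
  have [sound_E | unsound_E] := boolp.EM (sound E).
    by exists (instantiate (fun=> 0) E); split=> //; exists (fun=> 0).
  have [a unsound_Ea] : exists a, ~ sound_closed (instantiate a E).
    by apply/boolp.existsNP.
  exists (instantiate a E); split; last by exists a.
  by move=> /(_ _ erefl).
exists construct => [|n d S]; first exact: computable_construct.
have lt_B := tree_size_input d S; set B := tree_size _ in lt_B.
(* [T] is built from names and exponents alone, before [rho] is given, so it serves all
   environments. *)
pose T := emap (@subst_npoly B (root_two (B ^ B)) n) S.
exists T; split=> [|rho E F minE]; first exact: code_construct.
pose z := radical_val rho (root_two (B ^ B)).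
have instF : F = instantiate (fun i : 'I_n => z ^+ (B ^ i)) E.
  rewrite /F /T /E /instantiate /emap /= !dmap_comp.
  suffices -> : radical_val rho \o @subst_npoly B (root_two (B ^ B)) n
      = meval (fun i : 'I_n => z ^+ (B ^ i)) \o @npoly_val _ rho n by [].
  by apply: boolp.funext => s; apply: radical_val_npoly.
split; last by eexists; apply: instF.
move=> /(_ _ erefl); rewrite instF.
have B_gt0 : (0 < B)%N by apply: leq_ltn_trans lt_B.
have le_const := size_phase_constants rho S.
have le_deg := degree_phases rho S.
apply: (@sound_of_instance _ k n E d B (B ^ B)).
- move=> c /minE[p [mon_p pc0 _] le_pd]; exists p; split=> //.
  exact: monic_neq0.
- by rewrite expn_gt0 B_gt0.
- by rewrite /z /= rootCK // expn_gt0 B_gt0.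
- by apply: leq_ltn_trans le_deg _; lia.
- apply: exp_bound => //; first by lia.
  (* The phase constants are counted by the weights, which together with [n] stay below [B] by
     [lt_B]. *)
  by apply: leq_trans (leq_add le_const (leqnn n)) _; lia.
Qed.
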